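(* For every positive integer $k$, $\operatorname{sxdeg}(\mathcal{S}_+^k) = k$.
   Context: $\mathcal{S}^j$ is the vector space of real symmetric $j\times j$ matrices and $\mathcal{S}_+^j\subseteq \mathcal{S}^j$ is the cone of positive semidefinite ones. For a closed convex cone $K$ in a finite-dimensional real vector space $E$, a subset $S$ of a real vector space $V$ has a $K$-lift if $S = \pi(K \cap H)$ for some affine subspace $H$ of $E$ and some linear map $\pi: E \to V$. The semidefinite extension degree $\operatorname{sxdeg}(S)$ is the smallest positive integer $j$ such that $S$ has an $(\mathcal{S}_+^j)^m$-lift for some finite positive integer $m$, where $(\mathcal{S}_+^j)^m = \mathcal{S}_+^j\times\cdots\times\mathcal{S}_+^j$ ($m$ factors); $\operatorname{sxdeg}(S):=\infty$ if there is no such $j$. *)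

(* Defs.v *)
From mathcomp Require Import all_boot all_order all_algebra.
From mathcomp Require Import all_classical all_reals.

Set Implicit Arguments.
Unset Strict Implicit.
Unset Printing Implicit Defensive.

Import Order.TTheory GRing.Theory Num.Theory.

Local Open Scope classical_set_scope.
Local Open Scope ring_scope.

Section SymmetricMatrices.
Variables (R : realType) (j : nat).

Definition sym_space : {vspace 'M[R]_j} := fixedSpace (linfun (@trmx R j j)).

Lemma mem_sym_space (A : 'M[R]_j) : (A \in sym_space) = (A^T == A).
Proof.
apply/idP/eqP => [/fixedSpaceP|AT]; first by rewrite lfunE.
by apply/fixedSpaceP; rewrite lfunE.
Qed.

Definition sym_mx : vectType R := subvs_of sym_space.

Definition psd_cone : set sym_mx :=
  [set A | forall v : 'cV[R]_j, 0 <= (v^T *m vsval A *m v) 0 0].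

End SymmetricMatrices.

(* The m-fold product of a set K, inside the product space E ^ m. *)
Definition cone_power (R : realType) (E : vectType R) (K : set E) (m : nat) :
    set {ffun 'I_m -> E} :=
  [set x | forall i, K (x i)].

(* Translates p + U of linear subspaces, so nonempty by convention. *)
Definition affine_subspace (R : realType) (E : vectType R) (H : set E) : Prop :=
  exists (p : E) (U : {vspace E}), H = [set x | x - p \in U].

(* Intended for K a closed convex cone. *)
Definition has_lift (R : realType) (E : vectType R) (V : lmodType R)
    (K : set E) (S : set V) : Prop :=
  exists (H : set E) (pi : {linear E -> V}),
    affine_subspace H /\ S = pi @` (K `&` H).

Definition has_psd_lift (R : realType) (V : lmodType R) (S : set V)
    (j : nat) : Prop :=
  (0 < j)%N /\
  exists m : nat, (0 < m)%N /\ has_lift (cone_power (@psd_cone R j) (m := m)) S.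

Lemma has_psd_lift_ex (R : realType) (V : lmodType R) (S : set V) :
  (exists j, has_psd_lift S j) -> exists j, `[< has_psd_lift S j >].
Proof. by move=> [j Sj]; exists j; apply/asboolP. Qed.

(* The value None stands for infinity; ex_minn picks the least witness. *)
Definition sxdeg (R : realType) (V : lmodType R) (S : set V) : option nat :=
  if pselect (exists j, has_psd_lift S j) is left exj
  then Some (ex_minn (has_psd_lift_ex exj))
  else None.

(* Main.v *)
Require Import Defs.
From HB Require Import structures.
From mathcomp Require Import all_boot all_order all_algebra.
From mathcomp Require Import all_classical all_reals.
From mathcomp Require Import ring lra.

(** The bound sxdeg <= k is the trivial lift of the cone to itself. For the
    other bound, let j < k and suppose that the cone S_+^k is the projection pi
    of an affine section of (S_+^j)^m.

    Points on the moment curve, u_t = (1, t, ..., t^(k-1)), give rank-one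
    matrices x_t = u_t u_t^T that are neighborly: for every j parameters s and
    every further parameter t, the polynomial of degree j < k vanishing at s
    has a coefficient vector v such that the linear form X |-> v^T X v is
    nonnegative on the cone, zero at every x_u with u in s, and positive at x_t
    ([separating_col], [quad_rank1]).

    Choose a preimage L_t of x_t in the section for every natural number t. Each
    L_t consists of m matrices of size j, with m row spaces. Since there are
    infinitely many t while the total dimension is bounded, a greedy choice
    yields j parameters s and a t outside s such that each row space of L_t
    lies in the sum of the corresponding row spaces of the L_u, u in s
    ([exists_spanned_index]).
    For positive semidefinite matrices, an inclusion of row spaces turns into
    an inequality ([psd_dominated], [psd_span_sub_sum]): for a large constant C,
    the matrices C * (sum of the L_u) - L_t are positive semidefinite in every
    block. After normalization this is a point of the affine section, and its
    image is a positive multiple of C * (sum of the x_u) - x_t, on which the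
    linear form above is negative. This contradicts membership in the cone
    ([neighborly_no_psd_lift]). *)

Set Implicit Arguments.
Unset Strict Implicit.
Unset Printing Implicit Defensive.
Import Order.TTheory GRing.Theory Num.Theory.
Local Open Scope classical_set_scope.
Local Open Scope ring_scope.

(** * Infinite families of subspaces *)

Lemma rank_adds_gt (F : fieldType) (n : nat) (A B : 'M[F]_n) :
  ~~ (A <= B)%MS -> (\rank B < \rank (A + B))%N.
Proof.
apply: contraR; rewrite -leqNgt => rle.
apply: submx_trans (addsmxSl A B) _.
by rewrite -(geq_leqif (mxrank_leqif_sup (addsmxSr A B))).
Qed.

(** Restrict to an infinite set Y of indices for which the envelopes W i,
    containing all A t i with t in Y, have the least possible total rank. Then a
    proper subspace of W i contains A t i for finitely many t in Y only, so the
    indices can be chosen one by one in Y so that, for all i at once, every new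
    member enlarges the span until the span reaches W i. As
    W i has rank at most n, n members suffice, and any other index of Y is then
    a valid t. *)
Lemma exists_spanned_index (F : fieldType) (m n : nat)
    (A : nat -> 'I_m -> 'M[F]_n) :
  exists (s : seq nat) (t : nat), [/\ size s = n, t \notin s &
    forall i, (A t i <= \sum_(u <- s) A u i)%MS].
Proof.
pose P d := exists (W : 'I_m -> 'M[F]_n) (Y : set nat),
  [/\ infinite_set Y, forall t i, Y t -> (A t i <= W i)%MS &
      (\sum_i \rank (W i))%N = d].
have exP : exists d, `[< P d >].
  exists (\sum_(i < m) \rank (1%:M : 'M[F]_n))%N; apply/asboolP.
  exists (fun=> 1%:M), setT; split=> //; first exact: infinite_nat.
  by move=> t i _; exact: submx1.
have [d /asboolP [W [Y [infY AW dE]]] dmin] := ex_minnP exP.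
(* Otherwise B could replace W i, against the minimality of d. *)
have generic i (B : 'M_n) : (B <= W i)%MS -> (\rank B < \rank (W i))%N ->
    finite_set [set t | Y t /\ (A t i <= B)%MS].
  move=> BW rB; apply: contrapT => infB.
  pose W' l := if l == i then B else W l.
  have /dmin : `[< P (\sum_l \rank (W' l))%N >].
    apply/asboolP; exists W', [set t | Y t /\ (A t i <= B)%MS]; split=> //.
    by move=> t l [Yt AtB]; rewrite /W'; case: eqP => [->//|_]; exact: AW.
  rewrite leqNgt -dE => /negP; apply.
  rewrite (bigD1 i) //= [ltnRHS](bigD1 i) //= /W' eqxx -addSn leq_add //.
  by apply: leq_sum => l /negPf ->.
have spanW (s : seq nat) i : (forall u, u \in s -> Y u) ->
    (\sum_(u <- s) A u i <= W i)%MS.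
  move=> sY; rewrite big_seq.
  apply: (big_rec (fun B : 'M_n => (B <= W i)%MS)) => [|u B us BW].
    exact: sub0mx.
  by rewrite addsmx_sub BW AW //; exact: sY.
have pick (s : seq nat) : (forall u, u \in s -> Y u) ->
    exists t, [/\ Y t, t \notin s & forall i,
      (\rank (\sum_(u <- s) A u i)%MS < \rank (W i))%N ->
      ~~ (A t i <= \sum_(u <- s) A u i)%MS].
  move=> sY.
  pose bad i := [set t | [/\ Y t, (A t i <= \sum_(u <- s) A u i)%MS &
     (\rank (\sum_(u <- s) A u i)%MS < \rank (W i))%N]].
  have finbad : finite_set ([set` s] `|` \bigcup_(i in [set: 'I_m]) bad i).
    rewrite finite_setU; split; first exact: finite_seq.
    apply: bigcup_finite; first exact: finite_finset.
    move=> i _.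
    have [rlt|rge] :=
      ltnP (\rank (\sum_(u <- s) A u i)%MS) (\rank (W i)); last first.
      by rewrite (_ : bad i = set0) // -subset0 => t [_ _]; rewrite ltnNge rge.
    by apply: sub_finite_set (generic i _ (spanW s i sY) rlt) => t [].
  have /infinite_setN0 [t [Yt tbad]] :
      infinite_set (Y `\` ([set` s] `|` \bigcup_(i in [set: 'I_m]) bad i)).
    exact: infinite_setD.
  exists t; split=> //.
    by apply/negP => ts; apply: tbad; left.
  by move=> i rlt; apply/negP => AtB; apply: tbad; right; exists i.
have grow q : exists s : seq nat, [/\ size s = q, forall u, u \in s -> Y u &
    forall i, (minn q (\rank (W i)) <= \rank (\sum_(u <- s) A u i)%MS)%N].
  elim: q => [|q [s [sz sY sr]]].
    by exists [::]; split=> // i; rewrite min0n.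
  have [t [Yt _ tP]] := pick s sY.
  exists (t :: s); split=> /=; first by rewrite sz.
    by move=> u; rewrite inE => /orP[/eqP ->//|]; exact: sY.
  move=> i; rewrite big_cons.
  have [rge|rlt] := leqP (\rank (W i)) (\rank (\sum_(u <- s) A u i)%MS).
    rewrite geq_min; apply/orP; right.
    by apply: leq_trans rge (mxrankS _); exact: addsmxSr.
  have ltB : (\rank (\sum_(u <- s) A u i) <
      \rank (A t i + \sum_(u <- s) A u i))%N.
    exact: rank_adds_gt (tP i rlt).
  have := sr i; rewrite geq_min => /orP[qle|Wle].
    by rewrite geq_min (leq_ltn_trans qle ltB).
  by rewrite ltnNge Wle in rlt.
have [s [sz sY sr]] := grow n.
have [t [Yt ts _]] := pick s sY.
exists s, t; split=> // i.
apply: submx_trans (AW t i Yt) _.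
rewrite -(geq_leqif (mxrank_leqif_sup (spanW s i sY))).
by apply: leq_trans (sr i); rewrite leq_min leqnn rank_leq_row.
Qed.

(** * Quadratic forms of positive semidefinite matrices *)

Definition quad (R : realFieldType) n (A : 'M[R]_n) (v : 'cV[R]_n) : R :=
  (v^T *m A *m v) 0 0.

Section Psd.
Variables (R : realFieldType) (n : nat).
Implicit Types (A B : 'M[R]_n) (u v : 'cV[R]_n).

Lemma quadD A B v : quad (A + B) v = quad A v + quad B v.
Proof. by rewrite /quad mulmxDr mulmxDl mxE. Qed.

Lemma quadZ a A v : quad (a *: A) v = a * quad A v.
Proof. by rewrite /quad -scalemxAr -scalemxAl mxE. Qed.

Lemma quadN A v : quad (- A) v = - quad A v.
Proof. by rewrite -scaleN1r quadZ mulN1r. Qed.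

Lemma quad_sum (I : Type) (r : seq I) (F : I -> 'M[R]_n) v :
  quad (\sum_(i <- r) F i) v = \sum_(i <- r) quad (F i) v.
Proof.
by rewrite /quad mulmx_sumr mulmx_suml summxE.
Qed.

(** The form A is nonnegative on all combinations of u and v. *)
Lemma psd_cauchy_schwarz A u v : A^T = A -> (forall w, 0 <= quad A w) ->
  ((u^T *m A *m v) 0 0) ^+ 2 <= quad A u * quad A v.
Proof.
move=> symA psdA; set b := (_ *m v) 0 0.
have bE : (v^T *m A *m u) 0 0 = b.
  have -> : v^T *m A *m u = (u^T *m A *m v)^T.
    by rewrite !trmx_mul trmxK symA mulmxA.
  by rewrite mxE.
have pencil x y : 0 <= x ^+ 2 * quad A u + 2 * x * y * b + y ^+ 2 * quad A v.
  have := psdA (x *: u + y *: v); rewrite /quad.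
  rewrite [(_ + _)^T]linearD !linearZ /= !mulmxDl !mulmxDr -!scalemxAl -!scalemxAr.
  move: bE; rewrite /b !mxE => bE /le_trans; apply.
  rewrite le_eqVlt; apply/orP; left; apply/eqP.
  rewrite bE; ring.
(* The first combination minimizes the form when quad A v > 0; the second
   forces b = 0 when quad A v = 0. *)
move: (psdA u) (psdA v) (pencil (quad A v) (- b)) (pencil b (- (quad A u + 1))).
move: (quad A u) (quad A v) => a c.
rewrite le_eqVlt => a0; rewrite le_eqVlt => /orP[/eqP <-|c0] h1 h2; last first.
  have : 0 <= c * (a * c - b ^+ 2).
    by move: h1; rewrite (_ : _ + _ = c * (a * c - b ^+ 2)) //; ring.
  by rewrite pmulr_rge0 // subr_ge0.
rewrite mulr0; have {}a0 : 0 <= a by rewrite le_eqVlt.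
have : 0 <= - ((a + 2) * b ^+ 2).
  by move: h2; rewrite (_ : _ + _ = - ((a + 2) * b ^+ 2)) //; ring.
by rewrite oppr_ge0 pmulr_rle0 // ltr_wpDl.
Qed.

(** Cauchy-Schwarz against a basis vector. It bounds A v by the value of the
    form at v; in particular isotropic vectors lie in the kernel. *)
Lemma psd_col_sqr_le A (i : 'I_n) v : A^T = A -> (forall w, 0 <= quad A w) ->
  ((A *m v) i 0) ^+ 2 <= A i i * quad A v.
Proof.
move=> symA psdA.
have := psd_cauchy_schwarz (delta_mx i 0) v symA psdA.
have rE : (delta_mx i 0 : 'cV[R]_n)^T *m A = row i A by rewrite trmx_delta rowE.
rewrite {1}/quad rE -row_mul -colE !mxE.
by rewrite (_ : \sum_j _ = (A *m v) i 0) // mxE.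
Qed.

(** A vector v killed by A + B is isotropic for A, because the nonnegative
    values of A and B at v add up to zero; hence A v = 0. *)
Lemma psd_submx_addr A B : A^T = A -> (forall w, 0 <= quad A w) ->
  (forall w, 0 <= quad B w) -> (A <= (A + B)%R)%MS.
Proof.
move=> symA psdA psdB; rewrite submxE.
have := mulmx_coker (A + B); move: (cokermx _) => K ABK.
apply/eqP/matrixP => i j; rewrite [RHS]mxE.
have Av0 : quad A (col j K) = 0.
  apply/eqP; rewrite eq_le psdA andbT.
  have : quad (A + B) (col j K) = 0.
    by rewrite /quad colE -!mulmxA (mulmxA (A + B)) ABK mul0mx mulmx0 mxE.
  by rewrite quadD => /eqP; rewrite addr_eq0 => /eqP ->; rewrite oppr_le0.
have := psd_col_sqr_le i (col j K) symA psdA.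
rewrite Av0 mulr0 colE mulmxA -colE mxE => h; apply/eqP.
by rewrite -sqrf_eq0 eq_le h sqr_ge0.
Qed.

(** By symmetry A = B N B for some N, so the form A at v is the form N at B v,
    whose entries are controlled by the form B at v. *)
Lemma psd_dominated A B : A^T = A -> B^T = B -> (forall w, 0 <= quad B w) ->
  (A <= B)%MS -> exists2 c, 0 <= c & forall v, quad A v <= c * quad B v.
Proof.
move=> symA symB psdB AB.
have [N AE] : exists N, A = B *m N *m B.
  have := mulmxKpV AB; move: (pinvmx B) => P AP; exists (P^T *m A *m P).
  have AP' : B *m P^T *m A = A.
    by apply: trmx_inj; rewrite !trmx_mul trmxK symA symB mulmxA AP.
  by rewrite !mulmxA AP' AP.
have diagB i : 0 <= B i i.
  have := psdB (delta_mx i 0).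
  by rewrite /quad trmx_delta -rowE -colE !mxE.
exists (\sum_i \sum_j `|N i j| * (B i i + B j j)).
  apply: sumr_ge0 => i _; apply: sumr_ge0 => j _.
  by rewrite mulr_ge0 // addr_ge0.
move=> v; pose y := B *m v.
have -> : quad A v = \sum_i \sum_j N i j * (y i 0 * y j 0).
  have -> : quad A v = (y^T *m N *m y) 0 0.
    by rewrite /quad AE /y trmx_mul symB !mulmxA.
  rewrite mxE exchange_big /=; apply: eq_bigr => j _.
  rewrite mxE mulr_suml; apply: eq_bigr => i _; rewrite [y^T _ _]mxE; ring.
rewrite mulr_suml; apply: ler_sum => i _.
rewrite mulr_suml; apply: ler_sum => j _.
apply: le_trans (ler_norm _) _; rewrite normrM -mulrA ler_wpM2l //.
have hi := psd_col_sqr_le i v symB psdB.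
have hj := psd_col_sqr_le j v symB psdB.
rewrite -/y in hi hj; rewrite mulrDl; apply: le_trans (lerD hi hj).
move: (y i 0) (y j 0) => a b; rewrite ler_norml; nra.
Qed.
End Psd.

(** Positive semidefinite summands cannot cancel, so adding one more never
    loses part of the row space. *)
Lemma psd_span_sub_sum (R : realFieldType) n (I : Type) (r : seq I)
    (F : I -> 'M[R]_n) :
  (forall i, (F i)^T = F i) -> (forall i w, 0 <= quad (F i) w) ->
  (\sum_(i <- r) F i <= (\sum_(i <- r) F i)%R)%MS.
Proof.
move=> symF psdF; elim: r => [|i r IH]; first by rewrite !big_nil.
have psdS w : 0 <= quad (\sum_(l <- r) F l) w by rewrite quad_sum sumr_ge0.
have symS : (\sum_(l <- r) F l)^T = \sum_(l <- r) F l.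
  by rewrite linear_sum; apply: eq_bigr => l _; exact: symF.
rewrite !big_cons addsmx_sub psd_submx_addr //=.
by apply: submx_trans IH _; rewrite addrC psd_submx_addr.
Qed.

(** * Obstruction to lifts *)

(** The coefficients of the combination, c for every member of s and -1 for y,
    are divided by their sum. *)
Lemma affine_extrapolation (R : realType) (E : vectType R) (H : set E)
    (I : eqType) (s : seq I) (x : I -> E) (y : E) (c : R) :
  affine_subspace H -> {in s, forall i, H (x i)} -> H y ->
  c * (size s)%:R - 1 != 0 ->
  H ((c * (size s)%:R - 1)^-1 *: (c *: \sum_(i <- s) x i - y)).
Proof.
move=> [p [U ->]] Hx Hy; set d := _ - 1 => d0 /=.
suff -> : d^-1 *: (c *: \sum_(i <- s) x i - y) - p =
    d^-1 *: (c *: \sum_(i <- s) (x i - p) - (y - p)).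
  by rewrite rpredZ // rpredB // rpredZ // big_seq rpred_sum.
rewrite -[p in LHS](scalerK d0) -scalerBr; congr (_ *: _).
rewrite sumrB big_const_seq count_predT iter_addr_0 -scaler_nat.
rewrite scalerBr scalerA /d scalerBl scale1r !opprB.
by rewrite -!addrA; congr (_ + _); rewrite addrCA addrA addrC.
Qed.

(** An infinite family of points of S that is j-neighborly (any j of them are
    cut out from each other point by a form nonnegative on S) excludes lifts
    to blocks of size j. *)
Theorem neighborly_no_psd_lift (R : realType) (V : lmodType R) (S : set V)
    (j : nat) (x : nat -> V) :
  (forall t, S (x t)) ->
  (forall (s : seq nat) (t : nat), size s = j -> t \notin s ->
     exists f : {linear V -> R | *%R},
       [/\ forall y, S y -> 0 <= f y, forall u, u \in s -> f (x u) = 0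
         & f (x t) != 0]) ->
  ~ has_psd_lift S j.
Proof.
move=> Sx sep [j0 [m [_ [H [pi [affH SE]]]]]].
have /choice [L LP] : forall t, exists L,
    [/\ cone_power (@psd_cone R j) L, H L & pi L = x t].
  by move=> t; have := Sx t; rewrite SE => -[L [KL HL] piL]; exists L.
pose A t i := vsval (L t i).
have symA t i : (A t i)^T = A t i.
  by apply/eqP; rewrite -mem_sym_space; exact: subvsP.
have psdA t i w : 0 <= quad (A t i) w by have [K _ _] := LP t; exact: K.
have [s [t [sz ts spanA]]] := exists_spanned_index A.
have /choice [c cP] : forall i, exists c, 0 <= c /\
    forall w, quad (A t i) w <= c * quad (\sum_(u <- s) A u i) w.
  move=> i; case: (@psd_dominated _ _ (A t i) (\sum_(u <- s) A u i)) => //.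
  - by rewrite linear_sum; apply: eq_bigr => l _; exact: symA.
  - by move=> w; rewrite quad_sum sumr_ge0.
  - by apply: submx_trans (spanA i) _; exact: psd_span_sub_sum.
  by move=> c c0 cP; exists c.
(* The summand 2 makes the normalizing factor C * size s - 1 positive. *)
pose C := 2 + \sum_i c i.
have C2 : 2 <= C by rewrite lerDl sumr_ge0 // => i _; have [] := cP i.
have d0 : 0 < C * (size s)%:R - 1.
  rewrite sz subr_gt0; apply: lt_le_trans (_ : C * 1 <= _); first by lra.
  by rewrite ler_pM2l ?ler1n //; lra.
set d := _ - 1 in d0.
pose Z := d^-1 *: (C *: \sum_(u <- s) L u - L t).
have HZ : H Z.
  apply: affine_extrapolation => //; last by rewrite gt_eqF.
    by move=> u _; have [] := LP u.
  by have [] := LP t.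
have KZ : cone_power (@psd_cone R j) Z.
  move=> i w; rewrite -/(quad _ w).
  have -> : vsval (Z i) = d^-1 *: (C *: \sum_(u <- s) A u i - A t i).
    rewrite /Z !ffunE sum_ffunE linearZ /= linearB linearZ /= linear_sum.
    by rewrite scalerBr !scalerA mulrC.
  rewrite quadZ quadD quadZ quadN pmulr_rge0 ?invr_gt0 // subr_ge0.
  apply: le_trans (proj2 (cP i) w) _; rewrite ler_wpM2r //.
    by rewrite quad_sum sumr_ge0.
  rewrite /C (bigD1 i) //= addrCA lerDl addr_ge0 // sumr_ge0 // => l _.
  by have [] := cP l.
have [f [f0 fs ft]] := sep s t sz ts.
have /f0 : S (pi Z) by rewrite SE; exists Z.
have piE u : pi (L u) = x u by have [] := LP u.
have -> : pi Z = d^-1 *: (C *: \sum_(u <- s) x u - x t).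
  rewrite /Z linearZ_LR linearB linearZ_LR linear_sum /= piE.
  by under eq_bigr do rewrite piE.
rewrite linearZ_LR linearB linearZ_LR linear_sum /=.
rewrite big_seq big1 => [|u us]; last by rewrite fs.
have ft0 : 0 < f (x t) by rewrite lt_def ft f0.
by rewrite mulr0 sub0r pmulr_rge0 ?invr_gt0 // oppr_ge0 leNgt ft0.
Qed.

(** * The cone of positive semidefinite matrices *)

(** The entries of the vector are the coefficients of the polynomial with
    roots s. *)
Lemma separating_col (F : fieldType) (k : nat) (s : seq F) :
  (size s < k)%N -> exists v : 'cV[F]_k, forall x,
    ((v^T *m \col_i x ^+ i) 0 0 == 0) = (x \in s).
Proof.
move=> szs; pose p := \prod_(a <- s) ('X - a%:P).
exists (\col_i p`_i) => x; rewrite -root_prod_XsubC rootE -/p.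
rewrite (@horner_coef_wide _ k) ?size_prod_XsubC // mxE.
by congr (_ == _); apply: eq_bigr => i _; rewrite !mxE.
Qed.

Lemma quad_rank1 (R : realFieldType) n (u v : 'cV[R]_n) :
  quad (u *m u^T) v = ((v^T *m u) 0 0) ^+ 2.
Proof.
rewrite /quad mulmxA -mulmxA mxE big_ord1 expr2; congr (_ * _).
by rewrite -[u^T *m v]trmxK trmx_mul trmxK mxE.
Qed.

(** These linear forms in the matrix are nonnegative on the cone; they serve to
    separate points of the moment curve. *)
Definition quad_at (R : realType) k (v : 'cV[R]_k) (A : sym_mx R k) : R :=
  quad (vsval A) v.

Lemma quad_at_is_linear (R : realType) k (v : 'cV[R]_k) :
  linear_for *%R (quad_at v).
Proof. by move=> a A B; rewrite /quad_at linearP quadD quadZ. Qed.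

HB.instance Definition _ (R : realType) k (v : 'cV[R]_k) :=
  GRing.isLinear.Build R (sym_mx R k) R *%R (quad_at v) (quad_at_is_linear v).

Lemma psd_cone_no_smaller_lift (R : realType) (j k : nat) : (j < k)%N ->
  ~ has_psd_lift (@psd_cone R k) j.
Proof.
move=> jk; pose u (t : nat) : 'cV[R]_k := \col_i t%:R ^+ i.
pose x t : sym_mx R k := vsproj (sym_space R k) (u t *m (u t)^T).
have xE t v : quad_at v (x t) = ((v^T *m u t) 0 0) ^+ 2.
  by rewrite /quad_at vsprojK ?quad_rank1 // mem_sym_space trmx_mul trmxK.
apply: (@neighborly_no_psd_lift _ _ _ _ x) => [t v|s t sz ts].
  by have := xE t v; rewrite /quad_at /quad => ->; exact: sqr_ge0.
have [|v vP] := @separating_col R k [seq a%:R | a <- s].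
  by rewrite size_map sz.
exists (quad_at v); split=> [A psdA|a As|]; first exact: psdA.
  by apply/eqP; rewrite /= xE sqrf_eq0 vP map_f.
by rewrite /= xE sqrf_eq0 vP mem_map // => a b /eqP; rewrite eqr_nat => /eqP.
Qed.

(** Evaluation at i, named so that it can carry a linear structure. *)
Definition ffun_eval (R : realType) (E : vectType R) m (i : 'I_m)
  (x : {ffun 'I_m -> E}) : E := x i.

Lemma ffun_eval_is_linear (R : realType) (E : vectType R) m (i : 'I_m) :
  linear (@ffun_eval R E m i).
Proof. by move=> a x y; rewrite /ffun_eval !ffunE. Qed.

HB.instance Definition _ (R : realType) (E : vectType R) m (i : 'I_m) :=
  GRing.isLinear.Build R {ffun 'I_m -> E} E *:%R (@ffun_eval R E m i)
   (@ffun_eval_is_linear R E m i).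

Lemma psd_cone_self_lift (R : realType) (k : nat) : (0 < k)%N ->
  has_psd_lift (@psd_cone R k) k.
Proof.
move=> k0; split=> //; exists 1%N; split=> //.
exists setT, (@ffun_eval R (sym_mx R k) 1 ord0); split.
  by exists 0, fullv; apply/seteqP; split=> // x _ /=; exact: memvf.
apply/seteqP; split=> [A psdA|_ [x [Kx _] <-]]; last exact: Kx.
exists [ffun=> A]; last by rewrite /= /ffun_eval ffunE.
by split=> // i; rewrite ffunE.
Qed.

Theorem corollary6 (R : realType) (k : nat) (hk : (0 < k)%N) :
  sxdeg (@psd_cone R k) = Some k.
Proof.
rewrite /sxdeg; case: pselect => [exj|]; last first.
  by case; exists k; exact: psd_cone_self_lift.
case: ex_minnP => n /asboolP nlift nmin; congr Some.
apply/eqP; rewrite eqn_leq nmin; last first.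
  by apply/asboolP; exact: psd_cone_self_lift.
by rewrite leqNgt; apply/negP => nk; exact: psd_cone_no_smaller_lift nk nlift.
Qed.
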